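(* Let $M$ be a Coxeter matrix over a finite set $I$. For every $J\subset I$ the parabolic projection $p_J:(W(M),\star)\to (W_J(M),\star)$ maps parabolic elements to parabolic elements, i.e. is a parabolic homomorphism. Moreover, for any Coxeter matrices $M'$, $M$ over finite sets $I'$, $I$, every light homomorphism of Hecke monoids $\phi:(W(M'),\star)\to (W(M),\star)$, i.e. every homomorphism which sends each generator $s'_i$, $i\in I'$, to a generator $s_j$, $j\in I$, or to $1$, maps all parabolic elements to parabolic elements, i.e. is a parabolic homomorphism.
   Context: A Coxeter matrix over a finite set $I$ is a symmetric matrix $M=(m_{ij})_{i,j\in I}$ with $m_{ii}=1$ and $m_{ij}\in\mathbb Z_{\ge 2}\cup\{\infty\}$ for $i\ne j$. The Coxeter group $W(M)$ is generated by $s_i$, $i\in I$, subject to $(s_is_j)^{m_{ij}}=1$ whenever $m_{ij}\neq\infty$; $\ell$ is its length function. The Hecke monoid $(W(M),\star)$ (0-Hecke monoid) is the monoid generated by $s_i$, $i\in I$, subject to $s_i\star s_i=s_i$ and $s_i\star s_j\star\cdots=s_j\star s_i\star\cdots$ ($m_{ij}$ factors on each side) for $i\ne j$ with $m_{ij}<\infty$. Its underlying set is identified with $W(M)$ so that $s_i\star w=s_iw$ if $\ell(s_iw)>\ell(w)$ and $s_i\star w=w$ otherwise (and similarly on the right). Generators for $M'$ are denoted $s'_i$. Homomorphisms of monoids map identity to identity. For $J\subset I$, $W_J(M)$ is the subgroup generated by $s_j$, $j\in J$; $(W_J(M),\star)$ is the corresponding submonoid of the Hecke monoid. $J$ is of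 finite type if $W_J(M)$ is finite, and $\mathscr F(M)$ is the set of all subsets of $I$ of finite type. For $J\in\mathscr F(M)$, $w_\circ^J$ is the longest element of $W_J(M)$. For $J\subset K\in\mathscr F(M)$ put $w_{J;K}:=w_\circ^Jw_\circ^K$ (product in the Coxeter group $W(M)$); these are called ($K$-)parabolic elements. The support $\operatorname{supp} w$ of $w\in W(M)$ is the set of $i\in I$ such that $s_i$ occurs in a reduced expression of $w$. For a homomorphism of Hecke monoids $\phi:(W(M'),\star)\to(W(M),\star)$ set $[\phi](i)=\operatorname{supp}\phi(s'_i)$, $i\in I'$, and $[\phi](K')=\bigcup_{k\in K'}[\phi](k)$ for $K'\subset I'$; it is known that $[\phi](K')\in\mathscr F(M)$ whenever $K'\in\mathscr F(M')$. The homomorphism $\phi$ is called parabolic if for each $K'\in\mathscr F(M')$ and each $J'\subset K'$ there exists $J\subset[\phi](K')$ such that $\phi(w_{J';K'})=w_{J;[\phi](K')}$. The parabolic projection $p_J:(W(M),\star)\to(W_J(M),\star)$ is the homomorphism of monoids defined by $s_i\mapsto s_i$ for $i\in J$ and $s_i\mapsto 1$ for $i\in I\setminus J$. *)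

(* Defs.v *)
From HB Require Import structures.
From mathcomp Require Import all_boot.
From mathcomp Require Import boolp classical_sets cardinality.

Set Implicit Arguments.
Unset Strict Implicit.
Unset Printing Implicit Defensive.

Local Open Scope group_scope.

(* The monoid generated by I subject to u = v for all words with R u v: the
   quotient of the free monoid seq I by the congruence generated by R. *)
Section Presentation.
Variables (I : choiceType) (R : seq I -> seq I -> Prop).

Inductive word_cong : seq I -> seq I -> Prop :=
| WordRel a b u v of R u v : word_cong (a ++ u ++ b) (a ++ v ++ b)
| WordRefl u : word_cong u u
| WordSym u v of word_cong u v : word_cong v u
| WordTrans u v w of word_cong u v & word_cong v w : word_cong u w.

Definition word_congb (u v : seq I) : bool := `[< word_cong u v >].

Lemma word_congb_refl : reflexive word_congb.
Proof. by move=> u; apply/asboolP/WordRefl. Qed.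

Lemma word_congb_sym : symmetric word_congb.
Proof. by move=> u v; apply/asboolP/asboolP; apply: WordSym. Qed.

Lemma word_congb_trans : transitive word_congb.
Proof.
by move=> v u w /asboolP uv /asboolP vw; apply/asboolP/(WordTrans uv vw).
Qed.

Canonical word_congb_equiv :=
  EquivRel word_congb word_congb_refl word_congb_sym word_congb_trans.

Definition presented : Type := {eq_quot word_congb}%qT.

HB.instance Definition _ := Choice.on presented.

Definition word_class (u : seq I) : presented := (\pi_{eq_quot word_congb} u)%qT.
Definition word_repr (x : presented) : seq I :=
  repr (x : {eq_quot word_congb}%qT).

Lemma word_reprK : cancel word_repr word_class.
Proof. exact: reprK. Qed.

Lemma word_classP u v : word_class u = word_class v <-> word_cong u v.
Proof. by split => [/eqmodP/asboolP|uv] //; apply/eqmodP/asboolP. Qed.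

Lemma word_reprP u : word_cong (word_repr (word_class u)) u.
Proof. by apply/word_classP; rewrite word_reprK. Qed.

Lemma word_cong_cat u u' v v' :
  word_cong u u' -> word_cong v v' -> word_cong (u ++ v) (u' ++ v').
Proof.
move=> uu' vv'; apply: (@WordTrans _ (u' ++ v)).
  elim: uu' => {u u'} [a b u w Ruw|u|u w _|u w t _ + _].
  - by rewrite -!catA; apply: WordRel.
  - exact: WordRefl.
  - exact: WordSym.
  - exact: WordTrans.
elim: vv' => {v v'} [a b v w Rvw|v|v w _|v w t _ + _].
- by rewrite !(catA u'); apply: WordRel.
- exact: WordRefl.
- exact: WordSym.
- exact: WordTrans.
Qed.

Definition presented_one : presented := word_class [::].
Definition presented_mul (x y : presented) : presented :=
  word_class (word_repr x ++ word_repr y).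

Lemma word_class_cat u v :
  word_class (u ++ v) = presented_mul (word_class u) (word_class v).
Proof. by apply/word_classP/WordSym/word_cong_cat; apply: word_reprP. Qed.

Lemma presented_mulA : associative presented_mul.
Proof.
move=> x y z; rewrite -(word_reprK x) -(word_reprK y) -(word_reprK z).
by rewrite -!word_class_cat catA.
Qed.

Lemma presented_mul1 : left_id presented_one presented_mul.
Proof. by move=> x; rewrite -(word_reprK x) -word_class_cat. Qed.

Lemma presented_mulr1 : right_id presented_one presented_mul.
Proof. by move=> x; rewrite -(word_reprK x) -word_class_cat cats0. Qed.

HB.instance Definition _ := isMonoid.Build presented
  presented_mulA presented_mul1 presented_mulr1.

Lemma word_class_prod u : word_class u = \prod_(i <- u) word_class [:: i].
Proof.
elim: u => [|i u IHu]; first by rewrite big_nil.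
by rewrite big_cons -IHu -[i :: u]cat1s word_class_cat.
Qed.

Definition presented_lift (T : monoidType) (g : I -> T) (x : presented) : T :=
  \prod_(i <- word_repr x) g i.

Lemma presented_lift_cong (T : monoidType) (g : I -> T) :
    (forall u v, R u v -> \prod_(i <- u) g i = \prod_(i <- v) g i) ->
  forall u v, word_cong u v -> \prod_(i <- u) g i = \prod_(i <- v) g i.
Proof.
move=> gR u v; elim=> {u v} [a b u v /gR uv||//|u v w _ -> _ ->] //.
by rewrite !big_cat /= uv.
Qed.

Lemma presented_lift_class (T : monoidType) (g : I -> T) :
    (forall u v, R u v -> \prod_(i <- u) g i = \prod_(i <- v) g i) ->
  forall u, presented_lift g (word_class u) = \prod_(i <- u) g i.
Proof. by move=> gR u; apply: presented_lift_cong gR _ _ (word_reprP u). Qed.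

Lemma presented_lift_morph (T : monoidType) (g : I -> T) :
    (forall u v, R u v -> \prod_(i <- u) g i = \prod_(i <- v) g i) ->
  monoid_morphism (presented_lift g).
Proof.
move=> gR; split=> [|x y].
  by rewrite [1 in LHS]/(word_class [::]) presented_lift_class // big_nil.
rewrite -(word_reprK x) -(word_reprK y) -[_ * _]word_class_cat.
by rewrite !presented_lift_class // big_cat.
Qed.

End Presentation.

(* [Some m] is the finite entry m, [None] is the entry infinity. *)
Record coxeter_matrix (I : finType) := CoxeterMatrix {
  coxeter_entry :> I -> I -> option nat;
  coxeter_sym : forall i j, coxeter_entry i j = coxeter_entry j i;
  coxeter_diag : forall i, coxeter_entry i i = Some 1%N;
  coxeter_ge2 : forall i j m, i != j -> coxeter_entry i j = Some m -> (2 <= m)%N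
}.

Section CoxeterGroup.
Variables (I : finType) (M : coxeter_matrix I).
Implicit Types (u v : seq I) (J K : {set I}).

Definition coxeter_rel u v : Prop :=
  v = [::] /\ exists i j m, M i j = Some m /\ u = flatten (nseq m [:: i; j]).

(* As m_ii = 1, the relations include s_i s_i = 1, so that the monoid with this
   presentation is the group with this presentation. *)
Definition coxeter : Type := presented coxeter_rel.

HB.instance Definition _ := Monoid.on coxeter.

Definition cox_gen (i : I) : coxeter := word_class coxeter_rel [:: i].

Local Notation cong := (word_cong coxeter_rel).

Lemma cox_cong_rev u v : cong u v -> cong (rev u) (rev v).
Proof.
elim=> {u v} [a b u v [-> [i [j [m [Mij ->]]]]]|u|u v _|u v w _ + _].
- rewrite !rev_cat -!catA rev_flatten map_nseq rev_nseq.
  apply: (@WordRel _ coxeter_rel (rev b) (rev a) _ [::]); split=> //.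
  by exists j, i, m; rewrite coxeter_sym.
- exact: WordRefl.
- exact: WordSym.
- exact: WordTrans.
Qed.

Lemma cox_cong_revl u : cong (rev u ++ u) [::].
Proof.
elim: u => [|i u IHu]; first exact: WordRefl.
rewrite rev_cons cat_rcons; apply: WordTrans IHu.
apply: (@WordRel _ coxeter_rel (rev u) u [:: i; i] [::]); split=> //.
by exists i, i, 1%N; rewrite coxeter_diag.
Qed.

Definition cox_inv (x : coxeter) : coxeter :=
  word_class coxeter_rel (rev (word_repr x)).

Lemma cox_mulV : left_inverse (1 : coxeter) cox_inv *%g.
Proof.
move=> x; rewrite -[x in _ * x]word_reprK -[_ * _]word_class_cat.
exact/word_classP/cox_cong_revl.
Qed.

Lemma cox_mulrV : right_inverse (1 : coxeter) cox_inv *%g.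
Proof.
move=> x; rewrite -[x in x * _]word_reprK -[_ * _]word_class_cat.
by apply/word_classP; rewrite -[X in X ++ _]revK; apply: cox_cong_revl.
Qed.

HB.instance Definition _ := hasInv.Build coxeter cox_inv.
HB.instance Definition _ := Monoid_isGroup.Build coxeter cox_mulV cox_mulrV.

Definition cox_prod u : coxeter := \prod_(i <- u) cox_gen i.

Lemma cox_len_subproof (w : coxeter) :
  exists n, `[< exists2 u, size u = n & cox_prod u = w >].
Proof.
exists (size (word_repr w)); apply/asboolP; exists (word_repr w) => //.
by rewrite -[RHS]word_reprK word_class_prod.
Qed.

Definition cox_len (w : coxeter) : nat := ex_minn (cox_len_subproof w).

Definition reduced u : bool := size u == cox_len (cox_prod u).

Definition supp (w : coxeter) : {set I} :=
  [set i | `[< exists u, [/\ cox_prod u = w, reduced u & i \in u] >]].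

Definition cox_sub J : set coxeter :=
  smallest (fun G => group_closed (mem G)) [set cox_gen j | j in [set` J]]%classic.

Definition finite_type J : Prop := finite_set (cox_sub J).

(* The value 1 is taken when [cox_sub J] has no longest element, that is, when
   J is not of finite type. *)
Definition longest J : coxeter :=
  xget 1 [set w | cox_sub J w /\
                  forall v : coxeter, cox_sub J v -> (cox_len v <= cox_len w)%N]%classic.

Definition parabolic_elt J K : coxeter := longest J * longest K.

End CoxeterGroup.

Section HeckeMonoid.
Variables (I : finType) (M : coxeter_matrix I).
Implicit Types (u v : seq I) (J : {set I}).

(* The word i j i j ... with m letters. *)
Fixpoint alt_word (m : nat) (i j : I) : seq I :=
  if m is m'.+1 then i :: alt_word m' j i else [::].

Definition hecke_rel u v : Prop :=
  (exists i, u = [:: i; i] /\ v = [:: i]) \/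
  (exists i j m, [/\ i != j, M i j = Some m,
                     u = alt_word m i j & v = alt_word m j i]).

Definition hecke : Type := presented hecke_rel.

HB.instance Definition _ := Monoid.on hecke.

Definition hecke_gen (i : I) : hecke := word_class hecke_rel [:: i].

(* The identification of the underlying sets of W(M) and of the Hecke monoid.
   An element w of W(M) corresponds to the product in the Hecke monoid of the
   letters of a reduced expression of w (any one, by Matsumoto's theorem).
   Conversely x = s_i1 * ... * s_ik corresponds to the element of W(M) obtained
   by applying the rule for s_i * w successively, starting from 1. *)
Definition hecke_of_cox (w : coxeter M) : hecke :=
  \prod_(i <- xget [::] [set u | reduced M u /\ cox_prod M u = w]%classic)
     hecke_gen i.

Definition hecke_step (i : I) (w : coxeter M) : coxeter M :=
  if (cox_len w < cox_len (cox_gen M i * w)%g)%N then cox_gen M i * w else w.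

Definition cox_of_hecke (x : hecke) : coxeter M :=
  foldr hecke_step 1 (word_repr x).

Definition hecke_sub J : set hecke :=
  smallest (fun N => monoid_closed (mem N))
    [set hecke_gen j | j in [set` J]]%classic.

Lemma hecke_sub_gen J j : j \in J -> hecke_sub J (hecke_gen j).
Proof. by move=> jJ; apply: sub_gen_smallest; exists j. Qed.

Definition hecke_sub_pred J : pred hecke := fun x => `[< hecke_sub J x >].

Lemma hecke_sub_closed J : monoid_closed (hecke_sub_pred J).
Proof.
split=> [|x y /asboolP xJ /asboolP yJ]; apply/asboolP => N [] /= [N1 NM] genN.
  exact/set_mem.
by apply/set_mem/NM; apply/mem_set; [apply: xJ | apply: yJ].
Qed.

Record hecke_submonoid J := HeckeSubmonoid {
  hecke_val :> hecke; _ : hecke_sub_pred J hecke_val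
}.

HB.instance Definition _ J := [isSub for @hecke_val J].
HB.instance Definition _ J := [Choice of hecke_submonoid J by <:].
HB.instance Definition _ J :=
  SubChoice_isSubMonoid.Build hecke (hecke_sub_pred J) (hecke_submonoid J)
    (hecke_sub_closed J).

Lemma par_proj_gen_subproof J (i : I) :
  hecke_sub_pred J (if i \in J then hecke_gen i else 1).
Proof.
case: ifP => [iJ|_]; first by apply/asboolP; exact: hecke_sub_gen.
by case: (hecke_sub_closed J).
Qed.

Definition par_proj_gen J (i : I) : hecke_submonoid J :=
  HeckeSubmonoid (par_proj_gen_subproof J i).

Definition par_proj J : hecke -> hecke_submonoid J :=
  presented_lift (par_proj_gen J).

Lemma hecke_val_prod J u :
  hecke_val (\prod_(i <- u) par_proj_gen J i) =
  \prod_(i <- u) (if i \in J then hecke_gen i else 1).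
Proof.
by rewrite (big_morph (@hecke_val J) (id1 := 1) (op1 := *%g)).
Qed.

Lemma alt_word_idem (T : monoidType) (g : I -> T) m i j :
    g i = 1 -> g j * g j = g j ->
  g j * \prod_(k <- alt_word m i j) g k = g j /\
  g j * \prod_(k <- alt_word m j i) g k = g j.
Proof.
move=> gi gj; elim: m => [|m [IHi IHj]] /=; first by rewrite big_nil mulg1.
by rewrite !big_cons gi mul1g IHj mulgA gj IHi.
Qed.

Lemma alt_word_prod (T : monoidType) (g : I -> T) m i j :
    g i = 1 -> g j * g j = g j -> (2 <= m)%N ->
  \prod_(k <- alt_word m i j) g k = \prod_(k <- alt_word m j i) g k.
Proof.
case: m => [|[|m]] // gi gj _ /=; rewrite !big_cons gi !mul1g.
by case: (alt_word_idem m gi gj) => -> ->.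
Qed.

Lemma mem_alt_word m i j k : k \in alt_word m i j -> (k == i) || (k == j).
Proof.
elim: m i j => //= m IHm i j; rewrite inE => /orP[->//|/IHm].
by rewrite orbC.
Qed.

Lemma hecke_prod u : \prod_(i <- u) hecke_gen i = word_class hecke_rel u.
Proof. by rewrite word_class_prod. Qed.

Lemma hecke_genK i : hecke_gen i * hecke_gen i = hecke_gen i.
Proof.
rewrite -[LHS]word_class_cat; apply/word_classP.
apply: (@WordRel _ hecke_rel [::] [::] [:: i; i] [:: i]).
by left; exists i.
Qed.

Lemma par_proj_rel J u v : hecke_rel u v ->
  \prod_(i <- u) par_proj_gen J i = \prod_(i <- v) par_proj_gen J i.
Proof.
move=> uv; apply: val_inj; rewrite /= !hecke_val_prod.
pose g i : hecke := if i \in J then hecke_gen i else 1.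
rewrite -[LHS]/(\prod_(i <- u) g i) -[RHS]/(\prod_(i <- v) g i).
have gg i : g i * g i = g i.
  by rewrite /g; case: ifP => _; [apply: hecke_genK | apply: mulg1].
case: (uv) => [[i [-> ->]]|[i [j [m [ij Mij equ eqv]]]]].
  by rewrite !big_cons big_nil !mulg1 [LHS]gg.
have m2 := coxeter_ge2 ij Mij.
have [iJ|/negbTE iJ] := boolP (i \in J); last first.
  by rewrite equ eqv; apply: alt_word_prod => //; rewrite /g iJ.
have [jJ|/negbTE jJ] := boolP (j \in J); last first.
  by rewrite equ eqv; apply/esym/alt_word_prod => //; rewrite /g jJ.
have gP w : {in w, forall k, (k == i) || (k == j)} ->
    \prod_(k <- w) g k = word_class hecke_rel w.
  move=> wP; rewrite -hecke_prod; apply: eq_big_seq => k /wP.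
  by rewrite /g => /orP[]/eqP->; rewrite ?iJ ?jJ.
rewrite !gP; last 2 first.
- by move=> k; rewrite eqv => /mem_alt_word; rewrite orbC.
- by move=> k; rewrite equ => /mem_alt_word.
apply/word_classP; rewrite -[u]cats0 -[v]cats0.
exact: (@WordRel _ hecke_rel [::] [::]).
Qed.

HB.instance Definition _ J :=
  isUMagmaMorphism.Build hecke (hecke_submonoid J) (par_proj J)
    (presented_lift_morph (@par_proj_rel J)).

Lemma par_projE J i :
  hecke_val (par_proj J (hecke_gen i)) = if i \in J then hecke_gen i else 1.
Proof.
rewrite [par_proj J _](presented_lift_class (@par_proj_rel J)) hecke_val_prod.
by rewrite big_cons big_nil mulg1.
Qed.

End HeckeMonoid.

Section Homomorphisms.
Variables (I' I : finType) (M' : coxeter_matrix I') (M : coxeter_matrix I).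
Variable phi : UMagmaMorphism.type (hecke M') (hecke M).

Definition hecke_bracket (i : I') : {set I} :=
  supp (cox_of_hecke (phi (hecke_gen M' i))).

Definition hecke_bracket_set (K' : {set I'}) : {set I} :=
  \bigcup_(k in K') hecke_bracket k.

(* [phi](K') is of finite type whenever K' is, so that the two occurrences of
   [parabolic_elt] are about sets of finite type. *)
Definition parabolic : Prop :=
  forall K' J' : {set I'}, finite_type M' K' -> J' \subset K' ->
  exists2 J : {set I}, J \subset hecke_bracket_set K' &
    phi (hecke_of_cox (parabolic_elt M' J' K')) =
    hecke_of_cox (parabolic_elt M J (hecke_bracket_set K')).

Definition light : Prop :=
  forall i : I', (exists j : I, phi (hecke_gen M' i) = hecke_gen M j) \/
                 phi (hecke_gen M' i) = 1.

End Homomorphisms.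

(* Main.v *)
Require Import Defs.
From HB Require Import structures.
From mathcomp Require Import boolp classical_sets cardinality.
From mathcomp Require Import all_boot all_algebra all_field.
From mathcomp Require Import zify ring.

(** In a finite parabolic subgroup W_K with longest element w_K, conjugation by
    w_K permutes the generators, so x = w_J w_K satisfies: for every i in K,
    either s_i is a right descent of x or x s_i = s_j x for some j in K.
    Conversely this characterizes the parabolic elements y of W_K: put
    g = y w_K, let N be the set of left descents of g in K and write g = v h
    with v longest in W_N; if h <> 1, a right descent i of h satisfies
    g s_i = s_j g with j in N, whence g = (s_j v) (h s_i) with both factors
    shorter than v and h, which is absurd; so g = w_N and y = w_N w_K.
    In the Hecke monoid the condition says that x * s_i is x or s_j * x, and
    this is visibly preserved by homomorphisms sending generators to generators
    or to 1.

    Passing between the Coxeter group and the Hecke monoid rests on the exchange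
    condition (obtained from the action of W on signed reflections), on the
    order of s_i s_j being exactly m_ij (obtained from the geometric
    representation) and on Matsumoto's theorem; the identification is injective
    because the set of products of subwords is an invariant of a word in the
    Hecke monoid. *)

Set Implicit Arguments.
Unset Strict Implicit.
Unset Printing Implicit Defensive.

Local Open Scope group_scope.

(** * Actions of words and splittings of words *)

Lemma word_cong_foldr (I : choiceType) (R : seq I -> seq I -> Prop) (T : Type)
    (act : I -> T -> T) :
    (forall u v, R u v -> forall x, foldr act x u = foldr act x v) ->
  forall u v, word_cong R u v -> forall x, foldr act x u = foldr act x v.
Proof.
move=> actR u v.
elim=> {u v} [a b u v /actR uv|u|u v _ uv|u v w _ uv _ vw] x //.
  by rewrite !foldr_cat uv.
by rewrite uv.
Qed.

Lemma foldr_flatten_nseq (I T : Type) (act : I -> T -> T) m u x :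
  foldr act x (flatten (nseq m u)) = iter m (fun y => foldr act y u) x.
Proof. by elim: m => //= m IHm; rewrite foldr_cat IHm. Qed.

Lemma cat_eq_split (T : Type) (u v a b : seq T) (k : T) :
    u ++ v = a ++ k :: b ->
  (exists b', u = a ++ k :: b' /\ b = b' ++ v) \/
  (exists a', v = a' ++ k :: b /\ a = u ++ a').
Proof.
elim: u a => [|i u IHu] [|l a] /=; first by right; exists [::].
- by right; exists (l :: a).
- by case=> <- <-; left; exists u.
case=> -> /IHu[[b' [-> ->]]|[a' [-> ->]]]; first by left; exists b'.
by right; exists a'.
Qed.

Lemma subseq_catP (T : eqType) (t u v : seq T) : subseq t (u ++ v) ->
  exists a b, [/\ t = a ++ b, subseq a u & subseq b v].
Proof.
case/subseqP => m szm ->; rewrite -(cat_take_drop (size u) m) mask_cat.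
  by exists (mask (take (size u) m) u), (mask (drop (size u) m) v);
     rewrite !mask_subseq.
by rewrite size_takel // szm size_cat leq_addr.
Qed.

(** * The exchange condition *)

Section Coxeter.
Variables (I : finType) (M : coxeter_matrix I).
Implicit Types (i j k : I) (u v : seq I) (w x y g : coxeter M) (J K : {set I}).

Local Notation s := (cox_gen M).
Local Notation P := (cox_prod M).
Local Notation len := (@cox_len I M).

Lemma cox_prodE u : P u = word_class (coxeter_rel M) u.
Proof. by rewrite word_class_prod. Qed.

Lemma cox_prod_repr w : P (word_repr w) = w.
Proof. by rewrite cox_prodE word_reprK. Qed.

Lemma cox_prod_nil : P [::] = 1. Proof. exact: big_nil. Qed.

Lemma cox_prod_cons i u : P (i :: u) = s i * P u. Proof. exact: big_cons. Qed.

Lemma cox_prod1 i : P [:: i] = s i.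
Proof. by rewrite cox_prod_cons cox_prod_nil mulg1. Qed.

Lemma cox_prod_cat u v : P (u ++ v) = P u * P v. Proof. exact: big_cat. Qed.

Lemma cox_prod_rcons u i : P (rcons u i) = P u * s i.
Proof. by rewrite -cats1 cox_prod_cat cox_prod1. Qed.

Lemma cox_genK i : s i * s i = 1.
Proof.
rewrite -!cox_prod1 -cox_prod_cat cox_prodE; apply/word_classP.
apply: (@WordRel _ _ [::] [::] [:: i; i] [::]); split=> //.
by exists i, i, 1%N; rewrite coxeter_diag.
Qed.

Lemma cox_genV i : (s i)^-1 = s i.
Proof. exact/mulg1_eq/cox_genK. Qed.

Lemma cox_genKl i : cancel ( *%g (s i)) ( *%g (s i)).
Proof. by move=> w; rewrite mulgA cox_genK mul1g. Qed.

Lemma cox_genKr i : cancel ( *%g^~ (s i)) ( *%g^~ (s i)).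
Proof. by move=> w; rewrite -mulgA cox_genK mulg1. Qed.

Lemma cox_prod_rev u : P (rev u) = (P u)^-1.
Proof.
elim: u => [|i u IHu]; first by rewrite cox_prod_nil invg1.
by rewrite rev_cons cox_prod_rcons IHu cox_prod_cons invgM cox_genV.
Qed.

Lemma cox_len_prod u : (len (P u) <= size u)%N.
Proof.
rewrite /cox_len; case: ex_minnP => n _; apply.
by apply/asboolP; exists u.
Qed.

Lemma cox_lenP w : exists2 u, size u = len w & P u = w.
Proof.
by rewrite /cox_len; case: ex_minnP => n /asboolP[u <- <-] _; exists u.
Qed.

Lemma reducedP w : exists2 u, reduced M u & P u = w.
Proof.
by have [u szu uw] := cox_lenP w; exists u; rewrite // /reduced uw szu.
Qed.

Lemma cox_len1 : len 1 = 0%N.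
Proof. by apply/eqP; rewrite -leqn0 -cox_prod_nil cox_len_prod. Qed.

Lemma cox_len_eq0 w : len w = 0%N -> w = 1.
Proof. by have [[|i u] <- <-] := cox_lenP w; rewrite ?cox_prod_nil. Qed.

Lemma cox_lenM x y : (len (x * y)%g <= len x + len y)%N.
Proof.
have [u <- <-] := cox_lenP x; have [v <- <-] := cox_lenP y.
by rewrite -cox_prod_cat -size_cat cox_len_prod.
Qed.

Lemma cox_lenV w : len w^-1 = len w.
Proof.
suff le x : (len x^-1%g <= len x)%N.
  by apply/eqP; rewrite eqn_leq le /= -[w in (len w <= _)%N]invgK le.
have [u <- <-] := cox_lenP x.
by rewrite -cox_prod_rev -(size_rev u) cox_len_prod.
Qed.

Lemma cox_len_gen_le i : (len (s i) <= 1)%N.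
Proof. by rewrite -cox_prod1 (cox_len_prod [:: i]). Qed.

Lemma reduced_catP u v : reduced M (u ++ v) -> reduced M u /\ reduced M v.
Proof.
rewrite /reduced size_cat cox_prod_cat => /eqP uv.
have := cox_lenM (P u) (P v); rewrite -uv.
have := cox_len_prod u; have := cox_len_prod v.
by split; apply/eqP; lia.
Qed.

(* The reflection representation on signed reflections, extended to all of
   W x {+1, -1}: s_i conjugates t and flips the sign when t = s_i. *)
Definition wall_cross i (p : coxeter M * bool) : coxeter M * bool :=
  (s i * p.1 * s i, p.2 (+) (p.1 == s i)).

Lemma foldr_wall_cross1 u w e :
  (foldr wall_cross (w, e) u).1 = P u * w * (P u)^-1.
Proof.
elim: u => [|i u IHu] /=; first by rewrite cox_prod_nil invg1 mulg1 mul1g.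
by rewrite IHu cox_prod_cons invgM cox_genV !mulgA.
Qed.

Lemma foldr_wall_cross2 u w e :
  (foldr wall_cross (w, e) u).2 = e (+) (foldr wall_cross (w, false) u).2.
Proof.
elim: u => [|i u IHu] /=; first by rewrite addbF.
by rewrite IHu !foldr_wall_cross1 addbA.
Qed.

Lemma cox_rot_rel i j m : M i j = Some m -> (s i * s j) ^+ m = 1.
Proof.
move=> Mij.
have /word_classP : word_cong (coxeter_rel M) (flatten (nseq m [:: i; j])) [::].
  rewrite -[flatten _]cats0.
  apply: (@WordRel _ _ [::] [::] (flatten _) [::]); split=> //.
  by exists i, j, m.
rewrite -!cox_prodE cox_prod_nil => <-.
elim: m {Mij} => [|m IHm]; first by rewrite cox_prod_nil.
rewrite expgS [flatten _]/= -cat1s -[j :: _]cat1s !cox_prod_cat IHm.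
by rewrite !cox_prod1 mulgA.
Qed.

Lemma rot_conj_gen i j n : (s i * s j) ^+ n * s j = s j * ((s i * s j)^-1) ^+ n.
Proof.
elim: n => [|n IHn]; first by rewrite !expg0 mul1g mulg1.
by rewrite expgS -mulgA IHn invgM !cox_genV -!mulgA cox_genKl expgS mulgA
           [in RHS]mulgA cox_genK mul1g.
Qed.

(** Each round crosses two walls; over [n] rounds these are the reflections [s j * r ^+ l] of the
    dihedral group, in order of [l]. *)
Lemma iter_wall_cross i j r n w e : r = s i * s j ->
  iter n (fun p => wall_cross i (wall_cross j p)) (w, e) =
  (r ^+ n * w * r ^- n,
   e (+) \big[addb/false]_(0 <= l < n + n) (w == s j * r ^+ l)).
Proof.
move=> rE; have sr l : s j * r ^+ l = r ^- l * s j.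
  apply: (mulgI (r ^+ l)); rewrite mulgA rE rot_conj_gen -mulgA.
  by rewrite expVgn mulVg mulg1 mulVKg.
elim: n => [|n IHn].
  by rewrite big_geq // expg0 invg1 mulg1 mul1g addbF.
rewrite iterS IHn /wall_cross /= addSn addnS !big_nat_recr //= -!addbA.
have conjE z : (r ^+ n * w * r ^- n == z) = (w == r ^- n * z * r ^+ n).
  apply/eqP/eqP => [<-|->];
    by rewrite -!mulgA ?mulVg ?mulgV mulg1 ?mulKg ?mulVKg.
have eq1 : (r ^+ n * w * r ^- n == s j) = (w == s j * r ^+ (n + n)).
  by rewrite conjE -sr -mulgA -expgnDr.
have eq2 : (s j * (r ^+ n * w * r ^- n) * s j == s i) =
    (w == s j * r ^+ (n + n).+1).
  have -> : (s j * (r ^+ n * w * r ^- n) * s j == s i) =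
      (r ^+ n * w * r ^- n == s j * r).
    apply/eqP/eqP => [E|->]; last by rewrite cox_genKl rE cox_genKr.
    by apply/(mulgI (s j))/(mulIg (s j)); rewrite E cox_genKl rE cox_genKr.
  by rewrite conjE mulgA -sr -!mulgA -expgS -expgnDr addnS.
rewrite eq1 eq2; congr pair; rewrite expgS invgM.
by move: (r ^+ n) => rn; rewrite rE invgM !cox_genV -!mulgA.
Qed.

(** As [(s i * s j) ^+ m = 1], the flips for [l] and [l + m] agree, so the signs cancel in pairs. *)
Lemma wall_cross_rel u v : coxeter_rel M u v ->
  forall p, foldr wall_cross p u = foldr wall_cross p v.
Proof.
move=> [-> [i [j [m [Mij ->]]]]] [w e]; rewrite foldr_flatten_nseq /=.
rewrite (iter_wall_cross _ _ _ erefl) (cox_rot_rel Mij) invg1 mulg1 mul1g.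
rewrite (big_cat_nat (n := m)) ?leq_addr //=.
have -> : \big[addb/false]_(m <= l < m + m) (w == s j * (s i * s j) ^+ l) =
    \big[addb/false]_(0 <= l < m) (w == s j * (s i * s j) ^+ l).
  rewrite -[X in \big[_/_]_(X <= _ < _) _]add0n big_addn addnK.
  by apply: eq_bigr => l _; rewrite expgnDr (cox_rot_rel Mij) mulg1.
by rewrite addbb addbF.
Qed.

Lemma foldr_wall_cross_eq u v p : P u = P v ->
  foldr wall_cross p u = foldr wall_cross p v.
Proof.
rewrite !cox_prodE => /word_classP uv.
by apply: word_cong_foldr uv p; apply: wall_cross_rel.
Qed.

(** A flip occurs where the tail of [u] conjugates [s i] into the letter at hand; moving [s i]
    through the tail then cancels that letter. *)
Lemma wall_cross_del u i : (foldr wall_cross (s i, false) u).2 ->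
  exists a k b, u = a ++ k :: b /\ P u * s i = P (a ++ b).
Proof.
elim: u => //= k u IHu; rewrite foldr_wall_cross1.
case E: (foldr wall_cross (s i, false) u).2.
  have [a [l [b [-> uab]]]] := IHu E => _.
  exists (k :: a), l, b; split=> //.
  by rewrite cat_cons !cox_prod_cons -mulgA uab.
rewrite addFb => /eqP uk; exists [::], k, u; split=> //=.
by rewrite cox_prod_cons -[X in X * _ * _]uk -!mulgA mulKg cox_genK mulg1.
Qed.

Lemma wall_cross_rcons u i :
  (foldr wall_cross (s i, false) (rcons u i)).2 =
  ~~ (foldr wall_cross (s i, false) u).2.
Proof.
rewrite -cats1 foldr_cat /= /wall_cross /= cox_genKr eqxx.
by rewrite foldr_wall_cross2.
Qed.

(** The sign acquired by [s i] under a word depends only on the product of the word, and it differs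
    for [w] and [w * s i]. Deletion therefore applies to one of the two and shortens it. *)
Lemma exchange_alt i w :
  (len (w * s i)%g < len w)%N /\
    (forall u, P u = w ->
       exists a k b, u = a ++ k :: b /\ w * s i = P (a ++ b)) \/
  (len w < len (w * s i)%g)%N.
Proof.
have del x : (forall u, P u = x -> (foldr wall_cross (s i, false) u).2) ->
    (len (x * s i)%g < len x)%N /\
    (forall u, P u = x ->
       exists a k b, u = a ++ k :: b /\ x * s i = P (a ++ b)).
  move=> xP; have delx u : P u = x ->
       exists a k b, u = a ++ k :: b /\ x * s i = P (a ++ b).
    by move=> ux; rewrite -{1}ux; apply/wall_cross_del/xP.
  split=> //; have [u <- ux] := cox_lenP x.
  have [a [k [b [-> ->]]]] := delx u ux.
  by apply: leq_ltn_trans (cox_len_prod _) _; rewrite !size_cat /= addnS.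
case E: (foldr wall_cross (s i, false) (word_repr w)).2; [left|right].
  apply: del => u uw.
  by rewrite (@foldr_wall_cross_eq _ (word_repr w)) ?cox_prod_repr.
rewrite -{1}(cox_genKr i w); apply: (del _ _).1 => u uw.
rewrite (@foldr_wall_cross_eq _ (rcons (word_repr w) i)).
  by rewrite wall_cross_rcons E.
by rewrite cox_prod_rcons cox_prod_repr.
Qed.

Lemma cox_len_mulgen i w :
  (len (w * s i)%g < len w)%N = ~~ (len w < len (w * s i)%g)%N.
Proof. by case: (exchange_alt i w) => [[lt _]|lt]; lia. Qed.

Lemma cox_len_genmul i w :
  (len (s i * w)%g < len w)%N = ~~ (len w < len (s i * w)%g)%N.
Proof.
by rewrite -[len (_ * _)]cox_lenV -(cox_lenV w) invgM cox_genV cox_len_mulgen.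
Qed.

Lemma cox_len_mulgenS i w : (len w < len (w * s i)%g)%N ->
  len (w * s i) = (len w).+1.
Proof. by have := cox_lenM w (s i); have := cox_len_gen_le i; lia. Qed.

Lemma cox_len_genmulS i w : (len w < len (s i * w)%g)%N ->
  len (s i * w) = (len w).+1.
Proof. by have := cox_lenM (s i) w; have := cox_len_gen_le i; lia. Qed.

Lemma exchange i u : (len (s i * P u)%g < len (P u))%N ->
  exists a k b, u = a ++ k :: b /\ s i * P u = P (a ++ b).
Proof.
rewrite -cox_lenV -(cox_lenV (P u)) invgM cox_genV -cox_prod_rev => lt.
have [[_ /(_ (rev u) erefl)[a [k [b [ru uab]]]]]|] := exchange_alt i (P (rev u));
  last by rewrite ltnNge ltnW.
exists (rev b), k, (rev a); split.
  by rewrite -[u]revK ru rev_cat rev_cons cat_rcons.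
by apply: invg_inj; rewrite invgM cox_genV -!cox_prod_rev uab rev_cat !revK.
Qed.

End Coxeter.

(** * The geometric representation *)

Section GeometricRepresentation.
Import GRing.Theory Num.Theory.
Local Open Scope ring_scope.
Variables (I : finType) (M : coxeter_matrix I).
Implicit Types (i j k : I) (f : I -> algC).

(* For a primitive 2m-th root of unity z, -(z + 1/z) is the Cartan entry
   -2 cos(pi/m) up to Galois conjugation; for an entry infinity of M, any z that
   is not a root of unity will do. *)
Definition cartan_root i j : algC :=
  if M i j is Some m.+1 then sval (C_prim_root_exists (ltn0Sn m.*2.+1)) else 2.

Definition cartan i j : algC := - (cartan_root i j + (cartan_root i j)^-1).

Lemma cartan_rootP i j m : (0 < m)%N -> M i j = Some m ->
  (m.*2).-primitive_root (cartan_root i j).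
Proof.
by case: m => // m _; rewrite /cartan_root => ->; case: C_prim_root_exists.
Qed.

Lemma cartan_root_neq0 i j : cartan_root i j != 0.
Proof.
rewrite /cartan_root; case: (M i j) => [[|m]|]; rewrite ?pnatr_eq0 //.
case: C_prim_root_exists => z /= /prim_expr_order zn; apply/eqP => z0.
by move/eqP: zn; rewrite z0 expr0n eq_sym oner_eq0.
Qed.

Lemma cartan_root_sym i j : cartan_root i j = cartan_root j i.
Proof. by rewrite /cartan_root coxeter_sym. Qed.

Lemma cartan_sym i j : cartan i j = cartan j i.
Proof. by rewrite /cartan cartan_root_sym. Qed.

Lemma cartan_diag i : cartan i i = 2.
Proof.
have prim := cartan_rootP (ltn0Sn 0) (coxeter_diag M i).
have := prim_expr_order prim; have := prim_order_dvd prim 1.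
rewrite /cartan expr1; set z := cartan_root i i => /esym z1 /eqP.
rewrite -subr_eq0 subr_sqr_1 mulf_eq0 subr_eq0 z1 orFb addr_eq0 => /eqP ->.
by rewrite invrN1; ring.
Qed.

(** Here [f k] is the value of a linear form on the simple root of [k]; this is the dual of the
    reflection in the root of [i]. *)
Definition geom_refl i f : I -> algC := fun k => f k - cartan i k * f i.

Section Pair.
Variables i j : I.
Hypothesis ij : i != j.
Local Notation z := (cartan_root i j).

Definition geom_rot f := geom_refl i (geom_refl j f).

Lemma geom_rotE f k :
  geom_rot f k =
    f k - cartan j k * f j - cartan i k * (f i + (z + z^-1) * f j).
Proof.
by rewrite /geom_rot /geom_refl /cartan (cartan_root_sym j i); ring.
Qed.

(* Eigenfunctionals of the rotation, with eigenvalues z^2 and z^-2. *)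
Definition geom_eig (e : algC) f := f i + e * f j.

Lemma geom_eig_rot e f : e \in [:: z; z^-1] ->
  geom_eig e (geom_rot f) = e ^+ 2 * geom_eig e f.
Proof.
have z0 := cartan_root_neq0 i j.
rewrite !inE /geom_eig !geom_rotE !cartan_diag (cartan_sym j i) /cartan.
by case/orP => /eqP ->; field; exact: z0.
Qed.

Lemma geom_eig_iter e f n : e \in [:: z; z^-1] ->
  geom_eig e (iter n geom_rot f) = (e ^+ 2) ^+ n * geom_eig e f.
Proof.
move=> ez; elim: n => [|n IHn]; first by rewrite expr0 mul1r.
by rewrite iterS geom_eig_rot // IHn (exprS _ n) mulrA.
Qed.

(** The rotation changes [f k] by a combination of [f i] and [f j], which the two eigenfunctionals
    determine as [z] differs from [z^-1]. *)
Lemma geom_rot_eig k : z ^+ 2 != 1 ->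
  exists c d, forall f,
    geom_rot f k = f k + c * geom_eig z f + d * geom_eig z^-1 f.
Proof.
have z0 := cartan_root_neq0 i j => z1.
have z2 : z - z^-1 != 0.
  by apply: contra z1; rewrite subr_eq0 => /eqP zV; rewrite expr2 {2}zV mulfV.
have z3 : z ^+ 2 - 1 != 0 by rewrite subr_eq0.
pose b := cartan i k * z - cartan j k - cartan i k * (z + z^-1).
exists (- cartan i k + b / (z - z^-1)), (- b / (z - z^-1)).
move=> f; rewrite geom_rotE /geom_eig /b; field.
by rewrite z0 -expr2.
Qed.

(** The iterates change [f k] by multiples of the geometric sums of [z ^+ 2] and its inverse, which
    vanish for nontrivial [n]-th roots of unity. *)
Lemma geom_rot_iter f n : z ^+ 2 != 1 -> (z ^+ 2) ^+ n = 1 ->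
  iter n geom_rot f = f.
Proof.
move=> z1 zn; apply/funext => k.
have [c [d cd]] := geom_rot_eig k z1.
have iterE l : iter l geom_rot f k =
    f k + c * geom_eig z f * \sum_(t < l) (z ^+ 2) ^+ t
        + d * geom_eig z^-1 f * \sum_(t < l) (z^-1 ^+ 2) ^+ t.
  elim: l => [|l IHl]; first by rewrite !big_ord0 !mulr0 !addr0.
  rewrite iterS cd IHl !geom_eig_iter ?inE ?eqxx ?orbT // !big_ord_recr /=.
  ring.
have sum0 (e : algC) : e != 1 -> e ^+ n = 1 -> \sum_(t < n) e ^+ t = 0.
  move=> e1 en; have := subrX1 e n; rewrite en subrr => /esym/eqP.
  by rewrite mulf_eq0 subr_eq0 (negbTE e1) => /eqP.
by rewrite iterE !sum0 ?mulr0 ?addr0 // ?(exprVn, invr_eq1, zn, invr1).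
Qed.

End Pair.

Lemma geom_refl_rel u v : coxeter_rel M u v ->
  forall f, foldr geom_refl f u = foldr geom_refl f v.
Proof.
move=> [-> [i [j [m [Mij ->]]]]] f; rewrite foldr_flatten_nseq /=.
have [ij|ij] := eqVneq i j.
  have -> : m = 1%N by move: Mij; rewrite ij coxeter_diag => -[].
  apply/funext => k; rewrite ij /= /geom_refl cartan_diag; ring.
have m2 := coxeter_ge2 ij Mij.
have prim := cartan_rootP (ltnW m2) Mij.
apply: geom_rot_iter.
  by rewrite -(prim_order_dvd prim); apply/negP => /dvdn_leq; lia.
by rewrite -exprM mul2n prim_expr_order.
Qed.

End GeometricRepresentation.

(** * The order of a product of two generators *)

Section RotationOrder.
Variables (I : finType) (M : coxeter_matrix I).
Implicit Types (i j : I).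
Local Notation s := (cox_gen M).

(** A trivial [n]-th power acts trivially on linear forms, so the root [z] satisfies
    [z ^+ n.*2 = 1]; its order is [m.*2], and for the entry infinity [z] is 2. *)
Lemma cox_rot_order i j n : i != j -> (s i * s j) ^+ n = 1 ->
  if M i j is Some m then m %| n else n == 0%N.
Proof.
move=> ij rn.
have /word_classP cn :
    word_class (coxeter_rel M) (flatten (nseq n [:: i; j])) = word_class _ [::].
  rewrite -!cox_prodE cox_prod_nil -rn; elim: {rn} n => [|n IHn].
    by rewrite cox_prod_nil.
  rewrite expgS -IHn [flatten _]/= -cat1s -[j :: _]cat1s !cox_prod_cat.
  by rewrite !cox_prod1 mulgA.
(* The indicator of [i], on which the eigenfunctional takes the value 1. *)
pose f k : algC := (k == i)%:R%R.
have := word_cong_foldr (@geom_refl_rel I M) cn f; rewrite [in RHS]/=.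
rewrite foldr_flatten_nseq => /(congr1 (geom_eig i j (cartan_root M i j))).
rewrite geom_eig_iter ?inE ?eqxx //.
have -> : geom_eig i j (cartan_root M i j) f = 1%R.
  by rewrite /geom_eig /f /= eqxx eq_sym (negbTE ij) GRing.mulr0 GRing.addr0.
rewrite GRing.mulr1 -GRing.exprM mul2n => zn.
case Mij: (M i j) => [m|].
  have prim := cartan_rootP (ltnW (coxeter_ge2 ij Mij)) Mij.
  have : m.*2 %| n.*2 by rewrite (prim_order_dvd prim) zn eqxx.
  by rewrite -!mul2n dvdn_pmul2l.
move: zn; rewrite /cartan_root Mij => /eqP.
rewrite -GRing.natrX Num.Theory.pnatr_eq1 => /eqP pow1.
by have := ltn_expl n.*2 (ltnSn 1); rewrite pow1; case: n {rn cn pow1}.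
Qed.

Lemma cox_gen_inj : injective s.
Proof.
move=> i j sij; apply: contraPeq sij => ij sij.
have := @cox_rot_order i j 1 ij; rewrite expg1 sij cox_genK => /(_ erefl).
case Mij: (M i j) => [m|] //; have := coxeter_ge2 ij Mij.
by rewrite dvdn1; case: eqP => // ->.
Qed.

End RotationOrder.

(** * Parabolic subgroups *)

Section ParabolicSubgroups.
Variables (I : finType) (M : coxeter_matrix I).
Implicit Types (i j k : I) (u v : seq I) (w x y g : coxeter M) (J K : {set I}).

Local Notation s := (cox_gen M).
Local Notation P := (cox_prod M).
Local Notation len := (@cox_len I M).

Lemma cox_len_gen i : len (s i) = 1%N.
Proof.
have := cox_len_genmul i (s i); rewrite cox_genK cox_len1.
by have := cox_len_gen_le M i; case: (len _) => [|[]].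
Qed.

Lemma cox_len_eq1 w : len w = 1%N -> exists i, w = s i.
Proof.
move=> w1; have [u] := cox_lenP w; rewrite w1.
by case: u => [|i []] //= _ <-; exists i; rewrite cox_prod1.
Qed.

Lemma cox_subP J w : cox_sub J w <-> exists2 u, all [in J] u & P u = w.
Proof.
split=> [|[u uJ <-]].
  move=> /(_ [set x | exists2 u, all [in J] u & P u = x]%classic); apply.
  split=> [|_ [j jJ <-]]; last by exists [:: j]; rewrite ?cox_prod1 //= andbT.
  split=> [|x y].
    by apply/mem_set; exists [::]; rewrite ?cox_prod_nil.
  move=> /set_mem[u uJ <-] /set_mem[v vJ <-]; apply/mem_set.
  exists (u ++ rev v); first by rewrite all_cat uJ all_rev.
  by rewrite cox_prod_cat cox_prod_rev.
move=> G [] /= [G1 GF] genG; apply/set_mem.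
elim: u uJ => [|j u IHu] /=; first by rewrite cox_prod_nil.
case/andP => jJ /IHu uG; rewrite cox_prod_cons -[s j]cox_genV -[_^-1]mul1g.
have jG : s j \in G by apply/mem_set/genG; exists j.
(* Closure is given for 1 and quotients, so inverses and then products are built from quotients. *)
have VG x : x \in G -> x^-1 \in G by move=> xG; rewrite -[x^-1]mul1g; apply: GF.
by rewrite mul1g -[P u]invgK; apply: GF; apply: VG.
Qed.

Lemma cox_subM J x y : cox_sub J x -> cox_sub J y -> cox_sub J (x * y).
Proof.
rewrite !cox_subP => -[u uJ <-] [v vJ <-].
by exists (u ++ v); rewrite ?all_cat ?uJ // cox_prod_cat.
Qed.

Lemma cox_subV J x : cox_sub J x -> cox_sub J x^-1.
Proof.
rewrite !cox_subP => -[u uJ <-].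
by exists (rev u); rewrite ?all_rev ?cox_prod_rev.
Qed.

Lemma cox_sub1 J : cox_sub J (1 : coxeter M).
Proof. by apply/cox_subP; exists [::]; rewrite ?cox_prod_nil. Qed.

Lemma cox_sub_gen J j : j \in J -> cox_sub J (s j).
Proof.
by move=> jJ; apply/cox_subP; exists [:: j]; rewrite /= ?jJ ?cox_prod1.
Qed.

Lemma cox_subS J K x : J \subset K -> cox_sub J x -> cox_sub K x.
Proof.
move=> /subsetP JK /cox_subP[u /allP uJ <-]; apply/cox_subP; exists u => //.
by apply/allP => i /uJ; apply: JK.
Qed.

Lemma reduced_cons i u : reduced M (i :: u) ->
  reduced M u /\ (len (P u) < len (s i * P u)%g)%N.
Proof.
rewrite -cat1s => iu; have [_ ru] := reduced_catP iu; split=> //.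
by move: ru iu; rewrite /reduced /= cox_prod_cons => /eqP <- /eqP <-.
Qed.

Lemma reduced_consI i u : reduced M u -> (len (P u) < len (s i * P u)%g)%N ->
  reduced M (i :: u).
Proof.
by rewrite /reduced cox_prod_cons => /eqP /= -> /cox_len_genmulS ->.
Qed.

(** Letters are added from right to left; one that shortens the product cancels a letter of the
    reduced word already built. *)
Lemma reduced_subword u :
  exists v, [/\ subseq v u, reduced M v & P v = P u].
Proof.
elim: u => [|i u [v [vu rv Pv]]].
  by exists [::]; rewrite /reduced cox_prod_nil cox_len1.
have := cox_len_genmul i (P v); case: ltnP => lt /=; last first.
  move/esym; rewrite -leqNgt => le.
  exists (i :: v); rewrite /= eqxx vu !cox_prod_cons Pv; split=> //.
  apply: reduced_consI => //; have := cox_len_genmul i (P v).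
  by case: (ltnP (len (P v))) => //; rewrite ltnNge le.
move=> _; have [a [k [b [vab Pab]]]] := exchange lt.
exists (a ++ b); split.
- apply: subseq_trans (subseq_trans vu (subseq_cons u i)).
  by rewrite vab cat_subseq // subseq_cons.
- have szv : size v = (size (a ++ b)).+1 by rewrite vab !size_cat addnS.
  have := cox_lenM (s i) (s i * P v); rewrite cox_genKl cox_len_gen Pab.
  have := cox_len_prod M (a ++ b); move/eqP: rv; rewrite szv => <-.
  by rewrite /reduced => ? ?; apply/eqP; lia.
- by rewrite -Pab Pv cox_prod_cons.
Qed.

Lemma cox_sub_reduced J w : cox_sub J w ->
  exists u, [/\ reduced M u, all [in J] u & P u = w].
Proof.
move=> /cox_subP[u /allP uJ <-]; have [v [vu rv Pv]] := reduced_subword u.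
by exists v; split=> //; apply/allP => i /(mem_subseq vu)/uJ.
Qed.

(** The letter deleted from a concatenation of reduced words of [x] and [y] lies in one of the
    two. *)
Lemma exchangeM i x y : (len (s i * (x * y))%g < len (x * y)%g)%N ->
  (len (s i * x)%g < len x)%N \/
  exists2 z, s i * (x * y) = x * z & (len z < len y)%N.
Proof.
have [u /eqP szu <-] := reducedP x; have [v /eqP szv <-] := reducedP y.
rewrite -cox_prod_cat => /exchange[a [k [b [uvab sab]]]].
case: (cat_eq_split uvab) => [[b' [uE bE]]|[a' [vE aE]]]; [left|right].
  have -> : s i * P u = P (a ++ b').
    by apply: (mulIg (P v)); rewrite -mulgA -!cox_prod_cat sab bE catA.
  by apply: leq_ltn_trans (cox_len_prod _ _) _; rewrite -szu uE !size_cat /=; lia.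
exists (P (a' ++ b)); first by rewrite -cox_prod_cat catA -aE.
by apply: leq_ltn_trans (cox_len_prod _ _) _; rewrite -szv vE !size_cat /=; lia.
Qed.

(** Induction on a reduced word of [w]: the next letter [i] shortens [g] but lengthens the prefix
    [P u], so the exchange deletes a letter from the remaining factor. *)
Lemma desc_factor J g : (forall j, j \in J -> (len (s j * g)%g < len g)%N) ->
  forall w, cox_sub J w -> (len w + len (w^-1 * g)%g)%N = len g.
Proof.
move=> desc w /cox_sub_reduced[u [ru uJ <-]].
elim: u ru uJ => [|i u IHu]; first by rewrite cox_prod_nil invg1 mul1g cox_len1.
move=> /reduced_cons[ru lt] /andP[/desc ig /(IHu ru)].
set h := (P u)^-1 * g => lenh.
have gE : P u * h = g by rewrite /h mulVKg.
have [|lt'|[h' sg lth]] := @exchangeM i (P u) h; first by rewrite gE.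
  by rewrite ltnNge ltnW in lt.
have h'E : (P (i :: u))^-1 * g = h'.
  apply: (mulgI (P (i :: u))).
  by rewrite mulVKg cox_prod_cons -mulgA -sg gE cox_genKl.
rewrite h'E cox_prod_cons (cox_len_genmulS lt).
have := cox_lenM (s i * P u) h'.
rewrite -mulgA -sg cox_genKl gE (cox_len_genmulS lt).
by lia.
Qed.

End ParabolicSubgroups.

(** * Matsumoto's theorem and the Hecke monoid *)

Section HeckeIdentification.
Variables (I : finType) (M : coxeter_matrix I).
Implicit Types (i j k : I) (u v : seq I) (w x y g : coxeter M) (J K : {set I}).

Local Notation s := (cox_gen M).
Local Notation P := (cox_prod M).
Local Notation len := (@cox_len I M).

(** A bound on lengths serves in place of finiteness, for dihedral subgroups and for subsets of a
    finite type set. *)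
Lemma bounded_longest J n :
    (forall w, cox_sub J w -> (len w <= n)%N) ->
  exists2 g, cox_sub J g & forall w, cox_sub J w -> (len w <= len g)%N.
Proof.
move=> bnd; pose p l := `[< exists2 g, cox_sub J g & len g = l >].
have p0 : exists l, p l.
  exists 0%N; apply/asboolP.
  by exists 1; [exact: (@cox_sub1 I M J) | exact: cox_len1].
have pn l : p l -> (l <= n)%N by move=> /asboolP[g /bnd + <-].
have [l /asboolP[g gJ <-] max] := ex_maxnP p0 pn.
by exists g => // w wJ; apply/max/asboolP; exists w.
Qed.

Lemma max_desc J g : cox_sub J g ->
    (forall w, cox_sub J w -> (len w <= len g)%N) ->
  forall j, j \in J -> (len (s j * g)%g < len g)%N.
Proof.
move=> gJ max j jJ; rewrite cox_len_genmul -leqNgt.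
exact: max (cox_subM (@cox_sub_gen I M J j jJ) gJ).
Qed.

(** By [desc_factor], lengths of [w] and [w^-1 * g] add up to that of [g], so only [g] itself
    reaches its length. *)
Lemma longest_eq J g : cox_sub J g ->
  (forall j, j \in J -> (len (s j * g)%g < len g)%N) -> longest M J = g.
Proof.
move=> gJ /desc_factor fact; apply: xget_unique.
  by split=> // v /fact; lia.
move=> y [yJ max]; have := fact y yJ; have := max g gJ => le eq.
have /cox_len_eq0 yg : len (y^-1 * g) = 0%N by lia.
by apply/esym/(mulgI y^-1); rewrite mulVg.
Qed.

Lemma finite_type_longest J : finite_type M J ->
  cox_sub J (longest M J) /\
  forall j, j \in J -> (len (s j * longest M J)%g < len (longest M J))%N.
Proof.
move=> /finite_seqP[t tE].
have [g gJ max] : exists2 g, cox_sub J g &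
    forall w, cox_sub J w -> (len w <= len g)%N.
  apply: (@bounded_longest J (\max_(w <- t) len w)) => w.
  by rewrite tE /= => wt; rewrite (@leq_bigmax_seq _ t xpredT len).
have desc := max_desc gJ max.
by rewrite (longest_eq gJ desc).
Qed.

Lemma alt_word_prefix m n i j : (m <= n)%N ->
  exists r, @alt_word I n i j = alt_word m i j ++ r.
Proof.
elim: m n i j => [|m IHm] n i j; first by exists (alt_word n i j).
by case: n => // n; rewrite ltnS => /(IHm _ j i)[r /= ->]; exists r.
Qed.

Lemma size_alt_word m i j : size (@alt_word I m i j) = m.
Proof. by elim: m i j => //= m IHm i j; rewrite IHm. Qed.

(** Two equal consecutive letters would cancel. *)
Lemma reduced_alt_word i j u : i != j ->
    reduced M (i :: u) -> all [in [set i; j]] u ->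
  i :: u = alt_word (size u).+1 i j.
Proof.
elim: u i j => // k u IHu i j ij red /=; rewrite !inE => /andP[ki uij].
have [redu lt] := reduced_cons red.
have {ki} kj : k = j.
  case/orP: ki => /eqP // ki; move: lt; rewrite ki cox_prod_cons cox_genKl.
  have [_] := reduced_cons redu; rewrite ki => lt; by rewrite ltnNge ltnW.
rewrite kj in redu *; rewrite (IHu j i) //; first by rewrite eq_sym.
by apply: sub_all uij => l; rewrite /= !inE orbC.
Qed.

Lemma alt_word_rot i j n :
  P (alt_word n i j) * (P (alt_word n j i))^-1 = (s i * s j) ^+ n.
Proof.
elim: n i j => [|n IHn] i j /=; first by rewrite cox_prod_nil invg1 mulg1.
rewrite !cox_prod_cons invgM cox_genV mulgA -(mulgA (s i)) IHn.
elim: n {IHn} => [|n IHn]; first by rewrite expg0 mulg1 expg1.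
by rewrite expgSr [RHS]expgSr -IHn -!mulgA.
Qed.

(** Lengths in the dihedral subgroup are bounded by that of [g], so it has a longest element [v].
    The two alternating words of [v] give [(s i * s j) ^+ len v = 1], whence the entry is finite and
    divides [len v]; and [v] splits off from [g]. *)
Lemma dihedral_descent i j g : i != j ->
    (len (s i * g)%g < len g)%N -> (len (s j * g)%g < len g)%N ->
  exists m r, [/\ M i j = Some m, P (alt_word m i j ++ r) = g
    & reduced M (alt_word m i j ++ r)].
Proof.
move=> ij gi gj; pose J := [set i; j].
have fact : forall w, cox_sub J w -> (len w + len (w^-1 * g)%g)%N = len g.
  by apply: desc_factor => k; rewrite !inE => /orP[] /eqP ->.
have [v vJ max] : exists2 v, cox_sub J v &
    forall w, cox_sub J w -> (len w <= len v)%N.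
  by apply: (@bounded_longest J (len g)) => w /fact; lia.
have vdesc := max_desc vJ max.
(* Being longest, [v] has a reduced word starting with either letter, and this word alternates. *)
have altE a b : a != b -> [set a; b] = J -> P (alt_word (len v) a b) = v.
  move=> ab abJ; have aJ : a \in J by rewrite -abJ !inE eqxx.
  have [u [ru uJ uE]] :=
    cox_sub_reduced (cox_subM (@cox_sub_gen I M J a aJ) vJ).
  have va : P (a :: u) = v by rewrite cox_prod_cons uE cox_genKl.
  have red : reduced M (a :: u).
    by apply: reduced_consI => //; rewrite uE cox_genKl vdesc.
  have szv : (size u).+1 = len v by move: (eqP red); rewrite va.
  by rewrite -szv -(@reduced_alt_word a b u) // abJ.
have v_gt0 : (0 < len v)%N by have := vdesc i (set21 i j); lia.
have rotv : (s i * s j) ^+ len v = 1.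
  by rewrite -alt_word_rot !altE ?mulgV // 1?eq_sym // setUC.
have := cox_rot_order ij rotv; case Mij: (M i j) => [m|]; last by lia.
move=> /(dvdn_leq v_gt0)/(alt_word_prefix i j)[r rE].
have [u /eqP szu uE] := reducedP (v^-1 * g).
have gE : P (alt_word m i j ++ r ++ u) = g.
  by rewrite catA -rE cox_prod_cat altE // uE mulVKg.
exists m, (r ++ u); split=> //.
rewrite /reduced gE catA -rE size_cat size_alt_word szu uE.
by rewrite fact.
Qed.

Local Notation H := (word_class (hecke_rel M)).
Local Notation h := (hecke_gen M).

Lemma hecke_cat u v : H (u ++ v) = H u * H v.
Proof. exact: word_class_cat. Qed.

Lemma hecke_cons i u : H (i :: u) = h i * H u.
Proof. by rewrite -cat1s hecke_cat. Qed.

Lemma hecke_alt_word i j m : i != j -> M i j = Some m ->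
  H (alt_word m i j) = H (alt_word m j i).
Proof.
move=> ij Mij; apply/word_classP; rewrite -[X in word_cong _ X]cats0.
rewrite -[alt_word m j i]cats0; apply: (@WordRel _ _ [::] [::]).
by right; exists i, j, m.
Qed.

Lemma cox_alt_word i j m : M i j = Some m ->
  P (alt_word m i j) = P (alt_word m j i).
Proof.
move=> Mij; apply: (mulIg (P (alt_word m j i))^-1).
by rewrite alt_word_rot (cox_rot_rel Mij) mulgV.
Qed.

(** Induction on length. If the first letters [i] and [j] differ, both are descents, and the words
    [alt_word m i j ++ r] and [alt_word m j i ++ r] link [i :: u] to [j :: v]: a braid relation in
    the middle, a common first letter at each end. *)
Lemma matsumoto u v : reduced M u -> reduced M v -> P u = P v -> H u = H v.
Proof.
move sz: (size u) => n; elim: n u v sz => [|n IHn] [|i u] // [|j v] //= szu.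
- by move=> _ /eqP red /(congr1 len); rewrite -red cox_prod_nil cox_len1.
- by move=> /eqP red _ /(congr1 len); rewrite -red cox_prod_nil cox_len1.
have {}szu : size u = n by case: szu.
move=> ru rv uv.
have IHcons a t t' : size t = n -> reduced M (a :: t) -> reduced M (a :: t') ->
    P (a :: t) = P (a :: t') -> H (a :: t) = H (a :: t').
  move=> szt rt rt' tt'; rewrite !hecke_cons; congr (_ * _).
  have [{}rt _] := reduced_cons rt; have [{}rt' _] := reduced_cons rt'.
  by apply: IHn => //; apply: (mulgI (s a)); rewrite -!cox_prod_cons.
have szv : size v = n.
  by move: (eqP rv); rewrite -uv -(eqP ru) /= szu => -[].
have [ij|ij] := eqVneq i j.
  by move: rv uv; rewrite -ij => rv uv; apply: IHcons.
have desc a t : reduced M (a :: t) ->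
    (len (s a * P (a :: t))%g < len (P (a :: t)))%N.
  by rewrite cox_prod_cons cox_genKl => /reduced_cons[].
have := desc _ _ rv; rewrite -uv => dj.
have [m [r [Mij gE red]]] := dihedral_descent ij (desc _ _ ru) dj.
have m2 := coxeter_ge2 ij Mij.
have HE : H (alt_word m i j ++ r) = H (alt_word m j i ++ r).
  by rewrite !hecke_cat (hecke_alt_word ij Mij).
have PE := cox_alt_word Mij.
have red' : reduced M (alt_word m j i ++ r).
  move: red; rewrite /reduced !cox_prod_cat PE !size_cat.
  by rewrite !size_alt_word.
have gE' : P (alt_word m j i ++ r) = P (i :: u).
  by rewrite -gE !cox_prod_cat PE.
case: m m2 {Mij PE} => // m _ in gE gE' HE red red' *.
have := IHcons _ _ _ szu ru red (esym gE) => ->.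
rewrite HE; symmetry; apply: IHcons => //.
by rewrite -uv.
Qed.

Lemma hecke_of_coxE u : reduced M u -> hecke_of_cox (P u) = H u.
Proof.
move=> ru; rewrite /hecke_of_cox hecke_prod.
case: xgetP => [v _ [rv vu]|/(_ u)[]//]; exact: matsumoto.
Qed.

(** If [s i] does not lengthen [w], some reduced word of [w] starts with [i] and absorbs it by
    idempotence. *)
Lemma hecke_genM i w : h i * hecke_of_cox w = hecke_of_cox (hecke_step i w).
Proof.
rewrite /hecke_step; have [u ru <-] := reducedP w; case: ifP => lt.
  rewrite hecke_of_coxE // -hecke_cons -hecke_of_coxE ?cox_prod_cons //.
  exact: reduced_consI.
have [v rv vE] := reducedP (s i * P u).
have uE : P u = P (i :: v) by rewrite cox_prod_cons vE cox_genKl.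
have riv : reduced M (i :: v).
  by apply: reduced_consI => //; rewrite vE cox_genKl cox_len_genmul lt.
by rewrite uE hecke_of_coxE // hecke_cons mulgA hecke_genK.
Qed.

Lemma hecke_mulgen i w : (len w < len (w * s i)%g)%N ->
  hecke_of_cox w * h i = hecke_of_cox (w * s i).
Proof.
have [u /[dup] ru /eqP szu <-] := reducedP w => lt.
rewrite hecke_of_coxE // -cox_prod_rcons hecke_of_coxE.
  by rewrite -cats1 hecke_cat.
by rewrite /reduced cox_prod_rcons cox_len_mulgenS // size_rcons szu.
Qed.

Lemma hecke_mulgen_desc i w : (len (w * s i)%g < len w)%N ->
  hecke_of_cox w * h i = hecke_of_cox w.
Proof.
move=> lt; have wE : hecke_of_cox (w * s i) * h i = hecke_of_cox w.
  by rewrite hecke_mulgen cox_genKr.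
by rewrite -wE -mulgA hecke_genK.
Qed.

Lemma hecke_of_cox1 : hecke_of_cox 1 = 1 :> hecke M.
Proof.
by rewrite -(cox_prod_nil M) hecke_of_coxE // /reduced cox_prod_nil cox_len1.
Qed.

Lemma hecke_of_cox_foldr u : hecke_of_cox (foldr (@hecke_step I M) 1 u) = H u.
Proof.
elim: u => [|i u IHu] /=; first exact: hecke_of_cox1.
by rewrite -hecke_genM IHu hecke_cons.
Qed.

Lemma cox_of_heckeK : cancel (@cox_of_hecke I M) (@hecke_of_cox I M).
Proof. by move=> z; rewrite /cox_of_hecke hecke_of_cox_foldr word_reprK. Qed.

(** For reduced [u] this is the interval below [P u] in the Bruhat order. *)
Definition subword_prod u w := exists2 v, subseq v u & P v = w.

Lemma subword_prod_cat u v w : subword_prod (u ++ v) w <->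
  exists x y, [/\ subword_prod u x, subword_prod v y & x * y = w].
Proof.
split=> [[t /subseq_catP[a [b [-> au bv]]] <-]|
         [_ [_ [[a au <-] [b bv <-] <-]]]].
  by exists (P a), (P b); split; [exists a | exists b | rewrite cox_prod_cat].
by exists (a ++ b); rewrite ?cat_subseq // cox_prod_cat.
Qed.

(** A subword can be taken reduced, hence alternating; at full length the braid relation transfers
    it, and below that it occurs in both words. *)
Lemma subword_prod_alt i j m w : i != j -> M i j = Some m ->
  subword_prod (alt_word m i j) w -> subword_prod (alt_word m j i) w.
Proof.
move=> ij Mij [u um <-]; have [v [vu rv <-]] := reduced_subword M u.
have vm := subseq_trans vu um.
have szv : (size v <= m)%N by rewrite -(size_alt_word m i j) size_subseq.
have vij : all [in [set i; j]] v.
  by apply/allP => k /(mem_subseq vm)/mem_alt_word; rewrite !inE.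
case: v rv szv vij {vu vm} => [|k v] rv szv /=.
  by exists [::]; rewrite ?sub0seq.
case/andP => /set2P kij vij; case: kij rv => -> rv.
- rewrite (reduced_alt_word ij rv vij); move: szv; rewrite [size _]/=.
  move: (size v).+1 => n; rewrite leq_eqVlt => /orP[/eqP ->|lt].
    by exists (alt_word m j i); rewrite ?subseq_refl ?(cox_alt_word Mij).
  exists (alt_word n i j) => //.
  (* Past its first letter, [alt_word m j i] alternates from [i], with enough letters because
     [n < m]. *)
  case: m lt {um Mij} => // m; rewrite ltnS => /(alt_word_prefix i j)[r /= ->].
  exact: subseq_trans (prefix_subseq _ _) (subseq_cons _ _).
- rewrite eq_sym in ij; rewrite setUC in vij.
  have -> := reduced_alt_word ij rv vij.
  exists (alt_word (size v).+1 j i) => //.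
  by have [r ->] := alt_word_prefix j i szv; apply: prefix_subseq.
Qed.

Lemma hecke_subword_prod u v : word_cong (hecke_rel M) u v ->
  forall w, subword_prod u w <-> subword_prod v w.
Proof.
elim=> {u v} [a b u v uv|u|u v _ IH|u v t _ IH1 _ IH2] w //; last 2 first.
- by rewrite IH.
- by rewrite IH1 IH2.
have {}uv x : subword_prod u x <-> subword_prod v x.
  case: uv => [[i [-> ->]]|[i [j [m [ij Mij -> ->]]]]]; last first.
    split; apply: subword_prod_alt => //; first by rewrite eq_sym.
    by rewrite coxeter_sym.
  split=> -[t ti <-]; last by exists t; rewrite // (subseq_trans ti) //= eqxx.
  move/subseqP: ti => [[|b1 [|b2 []]]//= _ ->].
  (* Keeping both letters gives [s i * s i = 1], the product of the empty subword. *)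
  case: b1 b2 => [] [] /=.
  - by exists [::]; rewrite //= cox_prod_cons cox_prod1 cox_genK cox_prod_nil.
  - by exists [:: i]; rewrite //= eqxx.
  - by exists [:: i]; rewrite //= eqxx.
  - by exists [::].
by split=> /subword_prod_cat[x [y [ax /subword_prod_cat[z [t [uz bt <-]]] <-]]];
   apply/subword_prod_cat; exists x, (z * t); split=> //;
   apply/subword_prod_cat; exists z, t; split=> //; apply/uv.
Qed.

(** Each of two reduced words contains a subword for the product of the other; comparing lengths,
    such a subword is the whole word. *)
Lemma hecke_of_cox_inj : injective (@hecke_of_cox I M).
Proof.
move=> x y; have [u ru <-] := reducedP x; have [v rv <-] := reducedP y.
rewrite !hecke_of_coxE // => /word_classP /hecke_subword_prod uv.
have [v' v'v v'u] : subword_prod v (P u) by apply/uv; exists u.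
have [u' u'u u'v] : subword_prod u (P v) by apply/uv; exists v.
have le1 := cox_len_prod M v'; have le2 := cox_len_prod M u'.
rewrite v'u -(eqP ru) in le1; rewrite u'v -(eqP rv) in le2.
have := size_subseq_leqif v'v => -[le3 eq3]; have le4 := size_subseq u'u.
have : size v' == size v.
  by rewrite eqn_leq le3 (leq_trans le2 (leq_trans le4 le1)).
by rewrite eq3 => /eqP v'E; rewrite -v'u v'E.
Qed.

Lemma cox_of_hecke_of_cox : cancel (@hecke_of_cox I M) (@cox_of_hecke I M).
Proof. by move=> w; apply/hecke_of_cox_inj/cox_of_heckeK. Qed.

Lemma hecke_of_cox_gen i : hecke_of_cox (s i) = h i.
Proof.
rewrite -cox_prod1 hecke_of_coxE ?hecke_cons //; last first.
  by rewrite /reduced cox_prod1 cox_len_gen.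
exact: mulg1.
Qed.

Lemma supp1 : supp (1 : coxeter M) = set0.
Proof.
apply/setP => i; rewrite !inE; apply/asboolP => -[u [u1 /eqP]].
by rewrite u1 cox_len1 => /size0nil ->.
Qed.

Lemma supp_gen i : supp (s i) = [set i].
Proof.
apply/setP => j; rewrite !inE; apply/asboolP/eqP => [[u [ui /eqP]]|->].
  rewrite ui cox_len_gen; case: u ui => [|k []] //=.
  by rewrite cox_prod1 => /cox_gen_inj -> _; rewrite inE => /eqP.
by exists [:: i]; rewrite /reduced cox_prod1 cox_len_gen inE.
Qed.

Lemma cox_sub_genE J i : cox_sub J (s i) -> i \in J.
Proof.
case/cox_sub_reduced => u [/eqP ru uJ ui]; move: ru; rewrite ui cox_len_gen.
case: u ui uJ => [|k []] //=; rewrite cox_prod1 => /cox_gen_inj ->.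
by case/andP.
Qed.

Lemma hecke_step_eq i w : hecke_step i w = w -> (len (s i * w)%g < len w)%N.
Proof.
rewrite cox_len_genmul /hecke_step; case: ifP => // lt eq.
by move: lt; rewrite eq ltnn.
Qed.

(** * Parabolic elements *)

Section Longest.
Variables (K : {set I}) (g : coxeter M).
Hypotheses (gK : cox_sub K g)
  (desc : forall k, k \in K -> (len (s k * g)%g < len g)%N).

Lemma longest_mulr w : cox_sub K w -> (len w + len (w * g)%g)%N = len g.
Proof.
by move=> /cox_subV/(desc_factor desc); rewrite cox_lenV invgK.
Qed.

Lemma longest_invol : g * g = 1.
Proof. by apply: cox_len_eq0; have := longest_mulr gK; lia. Qed.

(** Multiplication by [g] complements lengths, so [g * s i * g] has length 1. *)
Lemma longest_comm i : i \in K -> exists2 j, j \in K & g * s i = s j * g.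
Proof.
move=> iK; have siK := @cox_sub_gen I M K i iK.
have gV : g^-1 = g by apply: mulg1_eq longest_invol.
have gsi : len (g * s i) = len (s i * g).
  by rewrite -cox_lenV invgM cox_genV gV.
have gsigK := cox_subM gK siK.
have [j gj] : exists j, g * s i * g = s j.
  apply: cox_len_eq1; have := longest_mulr gsigK; have := longest_mulr siK.
  by rewrite gsi cox_len_gen; lia.
exists j; first by apply: cox_sub_genE; rewrite -gj; apply: cox_subM.
by rewrite -gj -!mulgA longest_invol mulg1.
Qed.

End Longest.

Lemma finite_type_subset_longest J K : J \subset K -> finite_type M K ->
  cox_sub J (longest M J) /\
  forall j, j \in J -> (len (s j * longest M J)%g < len (longest M J))%N.
Proof.
move=> JK /finite_type_longest[gK desc].
have [x xJ max] := @bounded_longest J (len (longest M K)) (fun w wJ =>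
  leq_trans (leq_addr _ _) (eq_leq (desc_factor desc (cox_subS JK wJ)))).
by rewrite (longest_eq xJ (max_desc xJ max)); split=> //; apply: max_desc.
Qed.

Definition right_transport K x :=
  forall i, i \in K -> (len (x * s i)%g < len x)%N \/
    exists2 j, j \in K & x * s i = s j * x.

(** Exchange writes [s i] as a quotient of two products of letters in [J]. *)
Lemma cox_sub_desc J i w :
  cox_sub J w -> (len (s i * w)%g < len w)%N -> i \in J.
Proof.
move=> wJ; have [u uJ <-] := (cox_subP J _).1 wJ.
move=> /exchange[a [k [b [uE si]]]].
apply: cox_sub_genE; rewrite -[s i](mulgK (P u)) si.
apply: cox_subM; last by apply: cox_subV; apply/cox_subP; exists u.
apply/cox_subP; exists (a ++ b) => //.
by move: uJ; rewrite uE !all_cat /= => /and3P[-> _ ->].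
Qed.

(** Moving [s i] past the longest element of [K] gives some [s k]. If [k] is in [J], it moves on
    past that of [J]; otherwise it lengthens [x], and multiplication by [g] reverses lengths. *)
Lemma parabolic_elt_transport J K : J \subset K -> finite_type M K ->
  cox_sub K (parabolic_elt M J K) /\ right_transport K (parabolic_elt M J K).
Proof.
move=> JK finK; have [gK gdesc] := finite_type_longest finK.
have [xJ xdesc] := finite_type_subset_longest JK finK.
rewrite /parabolic_elt; set x := longest M J in xJ xdesc *.
set g := longest M K in gK gdesc *.
have xK := cox_subS JK xJ.
split=> [|i iK]; first exact: cox_subM.
have [k kK gk] := longest_comm gK gdesc iK; rewrite -mulgA gk mulgA.
have [kJ|kJ] := boolP (k \in J).
  have [j jJ ->] := longest_comm xJ xdesc kJ.
  right; exists j; last by rewrite mulgA.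
  exact: (subsetP JK).
left; have lt : (len x < len (x * s k)%g)%N.
  apply: contraR kJ => nlt; apply: (cox_sub_desc (cox_subV xJ)).
  rewrite -[len (s k * _)]cox_lenV -[len x^-1]cox_lenV invgM !invgK cox_genV.
  by rewrite cox_len_mulgen.
have := longest_mulr gdesc (cox_subM xK (@cox_sub_gen I M K k kK)).
have := longest_mulr gdesc xK => lenxg lenxkg.
by have : (len (x * s k * g)%g < len (x * g)%g)%N by lia.
Qed.

(** The assumptions on [longest M K] are stated by descents because [light_parabolic] obtains them
    for an image under [phi]. *)
Lemma transport_parabolic_elt K y :
    cox_sub K (longest M K) ->
    (forall k, k \in K -> (len (s k * longest M K)%g < len (longest M K))%N) ->
    cox_sub K y -> right_transport K y ->
  exists2 J : {set I}, J \subset K & y = parabolic_elt M J K.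
Proof.
rewrite /parabolic_elt; set g := longest M K => gK gdesc yK ytr.
pose z := y * g; have zK : cox_sub K z by apply: cox_subM.
pose N := [set j in K | (len (s j * z)%g < len z)%N].
have NK : N \subset K by apply/subsetP => j; rewrite inE => /andP[].
have Ndesc j : j \in N -> (len (s j * z)%g < len z)%N by rewrite inE => /andP[].
have Nfact := desc_factor Ndesc.
have ztr i : i \in K -> (len (z * s i)%g < len z)%N ->
    exists2 j, j \in N & z * s i = s j * z.
  move=> iK lt; have [k kK gk] := longest_comm gK gdesc iK.
  have zsi : z * s i = y * s k * g by rewrite -mulgA gk mulgA.
  (* If [s k] shortened [y], it would make [y * s k * g] longer than [z], against [lt]. *)
  case: (ytr k kK) => [ylt|[j jK yk]].
    have := longest_mulr gdesc (cox_subM yK (@cox_sub_gen I M K k kK)).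
    have := longest_mulr gdesc yK; move: lt; rewrite zsi /z; lia.
  have zj : z * s i = s j * z by rewrite zsi yk -mulgA.
  by exists j => //; rewrite inE jK -zj.
have [v vN max] := @bounded_longest N (len z) (fun w wN =>
  leq_trans (leq_addr _ _) (eq_leq (Nfact w wN))).
have vdesc := max_desc vN max.
have zE : z = v * (v^-1 * z) by rewrite mulVKg.
suff z0 : len (v^-1 * z) = 0%N.
  have zv : z = v by rewrite zE (cox_len_eq0 z0) mulg1.
  exists N => //; rewrite (longest_eq vN vdesc) -zv /z -mulgA.
  by rewrite (longest_invol gK gdesc) mulg1.
have rK : cox_sub K (v^-1 * z).
  exact: cox_subM (cox_subV (cox_subS NK vN)) zK.
have fv := Nfact v vN.
have [u [/eqP ru uK uE]] := cox_sub_reduced rK.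
case/lastP: u => [|u i] in ru uK uE *; first by rewrite -uE -ru.
have iK : i \in K by move: uK; rewrite all_rcons => /andP[].
have lti : (len (v^-1 * z * s i)%g < len (v^-1 * z)%g)%N.
  rewrite -uE -ru cox_prod_rcons cox_genKr size_rcons ltnS.
  exact: cox_len_prod.
(* A right descent of [v^-1 * z] is one of [z], since lengths add up in [v * (v^-1 * z)]. *)
have ltz : (len (z * s i)%g < len z)%N.
  have zsi : z * s i = v * (v^-1 * z * s i) by rewrite -!mulgA mulVKg.
  by have := cox_lenM v (v^-1 * z * s i); rewrite -zsi; lia.
have [j jN zj] := ztr i iK ltz.
(* The factors [s j * v] and [v^-1 * z * s i] of [z] are both shorter than before, yet [Nfact] makes
   their lengths sum to [len z]. *)
have vsj : (s j * v)^-1 * z = v^-1 * z * s i.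
  by rewrite invgM cox_genV -mulgA -zj mulgA.
have := Nfact _ (cox_subM (@cox_sub_gen I M N j jN) vN); rewrite vsj.
by have := vdesc j jN; lia.
Qed.

Lemma hecke_transport i j x : x * s i = s j * x ->
  hecke_of_cox x * h i = h j * hecke_of_cox x.
Proof.
move=> xij; rewrite hecke_genM /hecke_step -xij.
case: ifP => lt; first exact: hecke_mulgen.
by apply: hecke_mulgen_desc; rewrite cox_len_mulgen lt.
Qed.

End HeckeIdentification.

(** * Light homomorphisms *)

Section Light.
Variables (I' I : finType) (M' : coxeter_matrix I') (M : coxeter_matrix I).
Variable phi : UMagmaMorphism.type (hecke M') (hecke M).
Hypothesis phi_light : light phi.

Lemma bracket_setP (K' : {set I'}) i :
  reflect (exists2 k, k \in K' & phi (hecke_gen M' k) = hecke_gen M i)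
          (i \in hecke_bracket_set phi K').
Proof.
apply: (iffP bigcupP) => -[k kK' ki]; exists k => //; last first.
  rewrite /hecke_bracket ki -hecke_of_cox_gen cox_of_hecke_of_cox.
  by rewrite supp_gen inE.
move: ki; rewrite /hecke_bracket; case: (phi_light k) => [[j ->]| ->].
  by rewrite -hecke_of_cox_gen cox_of_hecke_of_cox supp_gen inE => /eqP ->;
    rewrite hecke_of_cox_gen.
by rewrite -hecke_of_cox1 cox_of_hecke_of_cox supp1 inE.
Qed.

(** Each letter of a reduced word of [x] maps to 1 or to a generator acting by [hecke_step], which
    stays in the subgroup. *)
Lemma light_lift (K' : {set I'}) x : cox_sub K' x ->
  exists2 y, cox_sub (hecke_bracket_set phi K') y &
             hecke_of_cox y = phi (hecke_of_cox x).
Proof.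
case/cox_sub_reduced => u [ru uK' <-]; rewrite hecke_of_coxE // {ru}.
elim: u uK' => [_|k u IHu] /=.
  exists 1; first exact: (@cox_sub1 I M).
  by rewrite hecke_of_cox1 -[word_class _ _]/(1 : hecke M') gmulf1.
case/andP => kK' /IHu[y yL yE].
rewrite hecke_cons gmulfM -yE; case: (phi_light k) => [[j kj]| ->]; last first.
  by exists y => //; rewrite mul1g.
exists (hecke_step j y); last by rewrite kj hecke_genM.
rewrite /hecke_step; case: ifP => // _; apply: cox_subM => //.
by apply: (@cox_sub_gen I M); apply/bracket_setP; exists k.
Qed.

(** The images [g] and [y] of the longest and of the parabolic element are recognized by Hecke
    identities, which [phi] preserves. *)
Lemma light_parabolic : parabolic phi.
Proof.
move=> K' J' finK' JK'; set L := hecke_bracket_set phi K'.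
have [gK' gdesc'] := finite_type_longest finK'.
have [xK' xtr] := parabolic_elt_transport JK' finK'.
have [g gL gE] := light_lift gK'.
have [y yL yE] := light_lift xK'.
(* The longest element absorbs every generator of [K'], so [g] absorbs their images. *)
have gdesc l : l \in L -> (cox_len (cox_gen M l * g)%g < cox_len g)%N.
  case/bracket_setP => k kK' kl; apply/hecke_step_eq/hecke_of_cox_inj.
  rewrite -hecke_genM gE -kl -gmulfM hecke_genM /hecke_step.
  by rewrite ifN // -cox_len_genmul gdesc'.
have gl := longest_eq gL gdesc.
have absorb i : hecke_of_cox y * hecke_gen M i = hecke_of_cox y ->
    (cox_len (y * cox_gen M i)%g < cox_len y)%N.
  rewrite cox_len_mulgen => yi; apply/negP => lt.
  move: yi (lt); rewrite hecke_mulgen // => /hecke_of_cox_inj ->.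
  by rewrite ltnn.
have ytr : right_transport L y.
  move=> i /bracket_setP[k kK' ki].
  case: (xtr k kK') => [/hecke_mulgen_desc xk|[j' jK' /hecke_transport xk]].
    by left; apply: absorb; rewrite yE -ki -gmulfM xk.
  have {xk} := congr1 phi xk; rewrite !gmulfM ki -yE.
  case: (phi_light j') => [[j jj]| ->]; last first.
    by rewrite mul1g; left; apply: absorb.
  rewrite jj hecke_genM /hecke_step.
  (* The Hecke identity yields [y * s_i = s_j * y] in the Coxeter group when both sides lengthen
     [y]; otherwise [s_i] is a right descent. *)
  case: ifP => _; last by left; apply: absorb.
  have [lt|] := boolP (cox_len (y * cox_gen M i)%g < cox_len y)%N.
    by left.
  rewrite cox_len_mulgen negbK => lt.
  rewrite hecke_mulgen // => /hecke_of_cox_inj yij.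
  by right; exists j => //; apply/bracket_setP; exists j'.
have [||J JL yJ] := transport_parabolic_elt _ _ yL ytr; rewrite ?gl //.
by exists J; rewrite // -yE yJ.
Qed.

End Light.

Theorem theorem1p1 :
  (forall (I : finType) (M : coxeter_matrix I) (J : {set I}),
     parabolic (\val \o par_proj J : hecke M -> hecke M)) /\
  (forall (I' I : finType) (M' : coxeter_matrix I') (M : coxeter_matrix I)
          (phi : UMagmaMorphism.type (hecke M') (hecke M)),
     light phi -> parabolic phi).
Proof.
split=> [I M J|I' I M' M phi]; last exact: light_parabolic.
apply: light_parabolic => i; rewrite /= par_projE.
by case: ifP => _; [left; exists i | right].
Qed.
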